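(* Let $\Xi=\{1,2,\ldots,m\}$ be an unconstrained target-cycle traversed repeatedly by a single agent that, after arriving at any target $n\in\Xi$, leaves it if and only if the target uncertainty $R_n$ reaches zero. Suppose that the matrix $\Delta_1^{-1}\Delta_2$ is Schur stable and that $\sum_{i=1}^{m}\frac{A_i}{B_i}<1$. Then the steady state mean cycle uncertainty of $\Xi$ is $$J_{ss}(\Xi)=\frac12(\bar B-\bar A)^{T}\bar\tau_{eq},$$ where $\bar B=[B_1,\ldots,B_m]^T$, $\bar A=[A_1,\ldots,A_m]^T$, and $\bar\tau_{eq}=[\tau_{1,eq},\ldots,\tau_{m,eq}]^T$ with $$\tau_{n,eq}=\left(\frac{\beta_n}{1-\sum_{i=1}^m\beta_i}\right)\rho_\Xi,\qquad \beta_n=\frac{A_n}{B_n},\quad n=1,\ldots,m.$$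
   Context: Targets are the nodes of a directed graph $\mathcal G=(\mathcal V,\mathcal E)$; travelling along edge $(i,j)\in\mathcal E$ takes a fixed time $\rho_{ij}\ge 0$. Each target $i$ has an uncertainty state $R_i(t)\ge 0$ with given $R_i(0)$ and parameters $A_i>0$, $B_i>0$, with dynamics: $\dot R_i(t)=0$ if $R_i(t)=0$ and $A_i\le B_iN_i(t)$, and $\dot R_i(t)=A_i-B_iN_i(t)$ otherwise, where $N_i(t)$ is the number of agents present at target $i$ at time $t$ (here $0$ or $1$, since there is a single agent). An unconstrained target-cycle is a finite sequence of pairwise distinct targets, relabelled $\Xi=\{1,2,\ldots,m\}$, such that $(m,1),(1,2),\ldots,(m-1,m)\in\mathcal E$. The agent visits $1,2,\ldots,m,1,2,\ldots$ cyclically, dwelling at each target and then travelling to the next; it follows this sequence forever. Write $\rho_n=\rho_{(n-1)n}$ for $n\ge2$, $\rho_1=\rho_{m1}$, and $\rho_\Xi=\sum_{i=1}^m\rho_i$ (total travel time of one tour). The steady state mean cycle uncertainty is $J_{ss}(\Xi)=\lim_{T\to\infty}\frac1T\int_0^T\sum_{j\in\Xi}R_j(t)\,dt$. Put $\alpha_n=\frac{B_n-A_n}{A_n}$ and $\bar\alpha=[\alpha_1,\ldots,\alpha_m]^T$. $\Delta_2\in\mathbb R^{m\times m}$ is the strictly upper triangular matrix all of whose entries above the diagonal equal $1$, and $\Delta_1=\mathrm{diag}(\bar\alpha)-\Delta_2^T$. (With $\bar\tau_k$ the vector of dwell times at targets $1,\ldots,m$ in the $k$-th tour, the dwell times obey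 $\Delta_1\bar\tau_{k+1}=\Delta_2\bar\tau_k+\bar 1_m\rho_\Xi$, where $\bar 1_m$ is the all-ones vector in $\mathbb R^m$.) A matrix is Schur stable if all its eigenvalues lie strictly inside the unit circle. *)

(* Defs.v *)
From HB Require Import structures.
From mathcomp Require Import all_boot all_order all_algebra.
From mathcomp Require Import complex.
From mathcomp Require Import all_classical all_reals all_analysis.

Set Implicit Arguments.
Unset Strict Implicit.
Unset Printing Implicit Defensive.

Import Order.TTheory GRing.Theory Num.Theory.
Import numFieldNormedType.Exports.

Local Open Scope classical_set_scope.
Local Open Scope ring_scope.

(* A target-cycle of length m = n.+1 >= 1 is a tuple [Xi : n.+1.-tuple V], so
   that the k-th target (k = 1 .. m) is [tnth Xi i] with i = k - 1. The visits
   of the agent are numbered 0, 1, 2, ... through all the tours: visit [v] is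
   to the target of index v mod m, in tour number v %/ m. *)

Definition visited (V : Type) (n : nat) (Xi : n.+1.-tuple V) (v : nat) : V :=
  tnth Xi (inZp v).

(* [ord_pred] is the cyclic predecessor, hence the first entry is the travel
   time from the last target back to the first one. *)
Definition leg_time (R : realType) (V : Type) (rho : V -> V -> R) (n : nat)
    (Xi : n.+1.-tuple V) (i : 'I_n.+1) : R :=
  rho (tnth Xi (ord_pred i)) (tnth Xi i).

Definition tour_time (R : realType) (V : Type) (rho : V -> V -> R) (n : nat)
    (Xi : n.+1.-tuple V) : R :=
  \sum_(i < n.+1) leg_time rho Xi i.

(* [arrive v] and [depart v] are the times at which visit [v] begins and ends.
   The last field says that the agent follows the cycle over all of [0, +oo[;
   it is automatic if the tour time is positive, and rules out a schedule whose
   infinitely many visits all take place before some finite time. *)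
Record cyclic_schedule (R : realType) (V : Type) (rho : V -> V -> R) (n : nat)
    (Xi : n.+1.-tuple V) (arrive depart : nat -> R) : Prop := CyclicSchedule {
  schedule_start : arrive 0%N = 0;
  schedule_dwell : forall v : nat, arrive v <= depart v;
  schedule_travel : forall v : nat,
    arrive v.+1 = depart v + leg_time rho Xi (inZp v.+1);
  schedule_forever : forall t : R, exists v : nat, t < arrive v
}.

(* The number N_i(t) of agents at target i; the single agent counts as present
   from its arrival until just before its departure. *)
Definition agents_at (R : realType) (V : Type) (n : nat) (Xi : n.+1.-tuple V)
    (arrive depart : nat -> R) (i : V) (t : R) : nat :=
  `[< exists v : nat, visited Xi v = i /\ arrive v <= t < depart v >].

Definition uncertainty_rate (R : realType) (a b r : R) (N : nat) : R :=
  if (r == 0) && (a <= b * N%:R) then 0 else a - b * N%:R.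

Definition switching_time (R : realType) (arrive depart : nat -> R) (t : R) :
    Prop :=
  exists v : nat, t = arrive v \/ t = depart v.

(* N_i jumps at arrivals and departures, so the differential equation is
   required between these instants, and continuity across them. *)
Record uncertainty_dynamics (R : realType) (V : Type) (A B R0 : V -> R)
    (n : nat) (Xi : n.+1.-tuple V) (arrive depart : nat -> R)
    (unc : V -> R -> R) : Prop := UncertaintyDynamics {
  unc_init : forall i : V, unc i 0 = R0 i;
  unc_ge0 : forall (i : V) (t : R), 0 <= t -> 0 <= unc i t;
  unc_continuous : forall i : V,
    {within [set t : R | 0 <= t], continuous (unc i)};
  unc_ode : forall (i : V) (t : R), 0 < t ->
    ~ switching_time arrive depart t ->
    is_derive t 1 (unc i)
      (uncertainty_rate (A i) (B i) (unc i t) (agents_at Xi arrive depart i t))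
}.

(* The agent leaves a target exactly when its uncertainty reaches zero: each
   departure is the first time, from the arrival on, at which it is zero. *)
Definition leaves_iff_zero (R : realType) (V : Type) (n : nat)
    (Xi : n.+1.-tuple V) (arrive depart : nat -> R) (unc : V -> R -> R) : Prop :=
  forall (v : nat) (t : R), arrive v <= t <= depart v ->
    (t = depart v <-> unc (visited Xi v) t = 0).

Definition mean_cycle_uncertainty (R : realType) (V : Type) (n : nat)
    (Xi : n.+1.-tuple V) (unc : V -> R -> R) (T : R) : R :=
  T^-1 * \int[@lebesgue_measure R]_(t in `[0, T]) (\sum_(j <- Xi) unc j t).

Definition alpha (R : realType) (V : Type) (A B : V -> R) (n : nat)
    (Xi : n.+1.-tuple V) : 'rV[R]_n.+1 :=
  \row_i ((B (tnth Xi i) - A (tnth Xi i)) / A (tnth Xi i)).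

Definition Delta2 (R : realType) (n : nat) : 'M[R]_n.+1 :=
  \matrix_(i, j) (i < j)%N%:R.

(* Lower triangular with diagonal [alpha]: it is invertible, so that [invmx] is
   the actual inverse, as soon as A_i <> B_i for every target of the cycle. *)
Definition Delta1 (R : realType) (V : Type) (A B : V -> R) (n : nat)
    (Xi : n.+1.-tuple V) : 'M[R]_n.+1 :=
  diag_mx (alpha A B Xi) - (Delta2 R n)^T.

Definition schur_stable (R : realType) (n : nat) (M : 'M[R]_n) : Prop :=
  forall z : complex R,
    eigenvalue (map_mx (real_complex R) M) z -> `|z| < 1.

Definition beta (R : realType) (V : Type) (A B : V -> R) (n : nat)
    (Xi : n.+1.-tuple V) (i : 'I_n.+1) : R :=
  A (tnth Xi i) / B (tnth Xi i).

Definition tau_eq (R : realType) (V : Type) (rho : V -> V -> R) (A B : V -> R)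
    (n : nat) (Xi : n.+1.-tuple V) : 'cV[R]_n.+1 :=
  \col_i (beta A B Xi i / (1 - \sum_(j < n.+1) beta A B Xi j)
          * tour_time rho Xi).

Definition cycle_vector (R : realType) (V : Type) (f : V -> R) (n : nat)
    (Xi : n.+1.-tuple V) : 'cV[R]_n.+1 :=
  \col_i f (tnth Xi i).

(* Main.v *)
Require Import Defs.
From mathcomp Require Import all_boot all_order all_algebra.
From mathcomp Require Import complex.
From mathcomp Require Import all_classical all_reals all_analysis.
From mathcomp Require Import lra ring zify.
Import Order.TTheory GRing.Theory Num.Theory.
Import numFieldNormedType.Exports.
Local Open Scope classical_set_scope.
Local Open Scope ring_scope.
Set Implicit Arguments.
Unset Strict Implicit.
Unset Printing Implicit Defensive.

(** Between its switching times every uncertainty is affine: a target gains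
    [A] per unit of time while the agent is away and, since the agent leaves as
    soon as the uncertainty vanishes, loses [B - A] during the whole of a visit.
    Seen from one departure to the next departure from the same target, its
    graph is therefore a triangle with base the return time and height
    [(B - A) * dwell], the return time being [(B / A) * dwell]. This gives two
    facts.

    - The return time is also one tour of travel plus the dwell times of the
      last [n.+1] visits. Each dwell time is thus [beta] times the total of the
      tour time and the last [n.+1] dwell times, itself included
      ([dwell_recurrence]). The vector [tau_eq] is the fixed point of this
      recurrence, and the deviation from it satisfies the homogeneous
      recurrence. The ratios [beta] being positive with sum [s < 1], a
      deviation that is at most [q * beta] over a tour is at most
      [q * s * beta] over the next one: the dwell times converge geometrically
      to [tau_eq] ([lag_recurrence_contracts], [dwell_deviation]).

    - The integral of the uncertainty over a return period is half the height
      times the length of the period ([Rintegral_unc_cycle]), so that it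
      differs from [(B - A) / 2 * tau_eq] times this length by an error
      proportional to [dwell - tau_eq].

    The errors of the successive periods are thus dominated by a geometric
    series, and [int_0^T unc - (B - A) / 2 * tau_eq * T] stays bounded
    ([integral_error_bounded]). Dividing by [T] gives the mean of each target
    ([target_mean]), and the theorem is the sum of these limits. *)

(** * Affine pieces of a function and their integrals *)

Definition affine_on (R : realType) (f : R -> R) (c a b : R) : Prop :=
  forall t : R, a <= t <= b -> f t = f a + c * (t - a).

Lemma affine_on_derive (R : realType) (f : R -> R) (c a b : R) :
  0 <= a -> {within [set t : R | 0 <= t], continuous f} ->
  (forall t, a < t < b -> is_derive t 1 f c) -> affine_on f c a b.
Proof.
move=> a0 cf df t /andP[at_ tb].
have [|||x _ /eqP] := @MVT_segment R f (fun=> c) a t.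
- exact: at_.
- move=> x; rewrite in_itv/= => /andP[ax xt]; apply: df.
  by rewrite ax (lt_le_trans xt).
- apply: continuous_subspaceW cf => x /=; rewrite in_itv/= => /andP[ax _].
  exact: le_trans ax.
by rewrite subr_eq addrC => /eqP.
Qed.

Lemma affine_on_trans (R : realType) (f : R -> R) (c a b d : R) :
  a <= b -> affine_on f c a b -> affine_on f c b d -> affine_on f c a d.
Proof.
move=> ab fab fbd t /andP[at_ td].
have [tb|/ltW bt] := leP t b; first by apply: fab; rewrite at_.
rewrite fbd ?bt// fab ?ab ?lexx//; ring.
Qed.

Lemma integrable_segment (R : realType) (f : R -> R) (a b : R) :
  0 <= a -> {within [set t : R | 0 <= t], continuous f} ->
  (@lebesgue_measure R).-integrable `[a, b] (EFin \o f).
Proof.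
move=> a0 cf; apply: continuous_compact_integrable.
  exact: segment_compact.
apply: continuous_subspaceW cf => x /=; rewrite in_itv/= => /andP[ax _].
exact: le_trans ax.
Qed.

Lemma Rintegral_chasles (R : realType) (f : R -> R) (a b c : R) :
  0 <= a -> {within [set t : R | 0 <= t], continuous f} -> a <= b -> b <= c ->
  \int[@lebesgue_measure R]_(t in `[a, c]) f t =
  \int[@lebesgue_measure R]_(t in `[a, b]) f t +
  \int[@lebesgue_measure R]_(t in `[b, c]) f t.
Proof.
move=> a0 cf ab bc.
have b0 := le_trans a0 ab.
apply/eqP; rewrite addrC -subr_eq; apply/eqP.
rewrite (Rintegral_itvB (integrable_segment _ a0 cf)) ?bnd_simp//.
apply: Rintegral_itv_obnd_cbnd.
apply: integrableS (integrable_segment c b0 cf) => //.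
by move=> x /=; rewrite !in_itv/= => /andP[/ltW -> ->].
Qed.

(** The trapezoid rule is exact on affine functions. *)
Lemma Rintegral_affine (R : realType) (f : R -> R) (c a b : R) :
  0 <= a -> {within [set t : R | 0 <= t], continuous f} -> a <= b ->
  affine_on f c a b ->
  \int[@lebesgue_measure R]_(t in `[a, b]) f t =
  (f a + f b) / 2 * (b - a).
Proof.
move=> a0 cf; rewrite le_eqVlt => /predU1P[<- _|ab fab].
  by rewrite set_itv1 Rintegral_set1 subrr mulr0.
pose F (t : R) := (t - a) * f a + c / 2 * (t - a) ^+ 2.
have dF (t : R) : is_derive t (1 : R) F (f a + c * (t - a)).
  by apply: is_derive_eq; rewrite /GRing.scale/=; field.
have cF : continuous F.
  move=> u; apply: differentiable_continuous; apply/derivable1_diffP.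
  exact: ex_derive.
transitivity (fine ((F b)%:E - (F a)%:E)%E); last first.
  by rewrite /= (fab b) ?lexx ?ltW// /F; field.
congr fine; apply: continuous_FTC2 => //.
- apply: continuous_subspaceW cf => x /=; rewrite in_itv/= => /andP[ax _].
  exact: le_trans ax.
- split.
  + by move=> t _; exact: ex_derive.
  + by apply: cvg_at_right_filter; exact: cF.
  + by apply: cvg_at_left_filter; exact: cF.
- move=> t; rewrite in_itv/= => /andP[at_ tb].
  by rewrite derive1E derive_val -fab// !ltW.
Qed.

(** * Contraction of linear recurrences with positive periodic weights *)

Lemma sum_period (R : realFieldType) (n : nat) (g : 'I_n.+1 -> R) (v : nat) :
  \sum_(j < n.+1) g (inZp (v + j)) = \sum_(i < n.+1) g i.
Proof.
rewrite [RHS](reindex_inj (addrI (inZp v : 'I_n.+1))); apply: eq_bigr => j _.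
by congr g; apply: val_inj; rewrite /= modnDml.
Qed.

(** The recurrence is implicit, as [e (v + n.+1)] also occurs in the sum. Once
    it is solved for, the bound [q] is multiplied by [(s - b v) / (1 - b v)],
    which is at most [s] because [s < 1]. *)
Lemma lag_recurrence_step (R : realFieldType) (n v : nat) (b e : nat -> R)
    (s q : R) :
  (forall w, 0 < b w) -> \sum_(j < n.+1) b (v + j)%N = s -> s < 1 -> 0 <= q ->
  e (v + n.+1)%N = b v * \sum_(j < n.+1) e (v.+1 + j)%N ->
  (forall j, (j < n)%N -> `|e (v.+1 + j)%N| <= q * b (v.+1 + j)%N) ->
  `|e (v + n.+1)%N| <= q * s * b v.
Proof.
move=> b0 bs s1 q0 ev le_e.
pose y := \sum_(j < n) e (v.+1 + j)%N.
have sb : \sum_(j < n) b (v.+1 + j)%N = s - b v.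
  rewrite -bs big_ord_recl addn0 [b v + _]addrC addrK.
  by apply: eq_bigr => j _; rewrite /bump/= addSnnS.
have yq : `|y| <= q * (s - b v).
  rewrite -sb mulr_sumr; apply: le_trans (ler_norm_sum _ _ _) _.
  by apply: ler_sum => j _; exact: le_e.
have bs_le : b v <= s.
  by rewrite -subr_ge0 -sb; apply: sumr_ge0 => j _; exact: ltW.
have bv := b0 v.
have ex : (1 - b v) * e (v + n.+1)%N = b v * y.
  by move: ev; rewrite big_ord_recr/= -/y addSnnS => ev; rewrite {1}ev; nra.
have b1 : 0 < 1 - b v by lra.
rewrite -(ler_pM2l b1) -[X in X * _](gtr0_norm b1) -normrM ex normrM.
rewrite gtr0_norm//.
apply: le_trans (ler_wpM2l (ltW bv) yq) _.
rewrite -subr_ge0.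
have -> : (1 - b v) * (q * s * b v) - b v * (q * (s - b v)) =
  b v * b v * q * (1 - s) by ring.
by rewrite !mulr_ge0 ?subr_ge0// ltW.
Qed.

(** Contraction in the sup norm weighted by [b]: each period of [n.+1] steps
    gains a factor [s]. *)
Lemma lag_recurrence_contracts (R : realFieldType) (n : nat) (b e : nat -> R)
    (s : R) :
  (forall v, 0 < b v) -> (forall v, b (v + n.+1)%N = b v) ->
  (forall v, \sum_(j < n.+1) b (v + j)%N = s) -> s < 1 ->
  (forall v, e (v + n.+1)%N = b v * \sum_(j < n.+1) e (v.+1 + j)%N) ->
  exists2 K, 0 <= K &
    forall k v, (k * n.+1 <= v)%N -> `|e v| <= K * s ^+ k * b v.
Proof.
move=> b0 bper bs s1 ev.
have s0 : 0 <= s by rewrite -(bs 0%N); apply: sumr_ge0 => j _; exact: ltW.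
pose K := \sum_(j < n.+1) `|e j| / b j.
have K0 : 0 <= K by apply: sumr_ge0 => j _; rewrite divr_ge0// ltW.
(* As a sum of nonnegative terms, K dominates [`|e j| / b j] for each [j] of
   the first period; the bound is then extended to all [v] before any decay. *)
exists K => //; elim=> [|k IHk] v.
  move=> _; rewrite expr0 mulr1.
  elim/ltn_ind: v => v IHv; have [vn|nv] := ltnP v n.+1.
    rewrite -ler_pdivrMr// /K (bigD1 (Ordinal vn))//= lerDl.
    by apply: sumr_ge0 => j _; rewrite divr_ge0// ltW.
  have [w vw] : exists w, v = (w + n.+1)%N by exists (v - n.+1)%N; lia.
  rewrite vw bper; apply: (@le_trans _ _ (K * s * b w)).
    apply: lag_recurrence_step (bs w) s1 K0 (ev w) _ => // j jn.
    by apply: IHv; lia.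
  by rewrite ler_pM2r// ler_piMr// ltW.
move=> kv.
have [w vw] : exists w, v = (w + n.+1)%N by exists (v - n.+1)%N; lia.
rewrite vw bper exprSr mulrA.
apply: lag_recurrence_step (bs w) s1 _ (ev w) _ => //.
  by rewrite mulr_ge0// exprn_ge0.
by move=> j jn; apply: IHk; lia.
Qed.

(** * Long-run means from integrals over successive periods *)

Lemma mean_cvg_of_bounded_error (R : realType) (F : R -> R) (L M T0 : R) :
  (forall T, T0 <= T -> `|F T - L * T| <= M) ->
  T^-1 * F T @[T --> +oo] --> L.
Proof.
move=> FM; apply/cvgrPdist_le => eps eps0; near=> T.
have T1 : 1 <= T by near: T; apply: nbhs_pinfty_ge; rewrite num_real.
have TM : M / eps <= T by near: T; apply: nbhs_pinfty_ge; rewrite num_real.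
have T0T : T0 <= T by near: T; apply: nbhs_pinfty_ge; rewrite num_real.
have Tgt0 : 0 < T by lra.
rewrite distrC -(ler_pM2l Tgt0) -[X in X * _](gtr0_norm Tgt0) -normrM.
have -> : T * (T^-1 * F T - L) = F T - L * T by field; rewrite gt_eqF.
by apply: le_trans (FM _ T0T) _; rewrite -ler_pdivrMr.
Unshelve. all: by end_near.
Qed.

Lemma geometric_psum_le (R : realFieldType) (s : R) (k : nat) :
  0 <= s -> s < 1 -> \sum_(j < k) s ^+ j <= (1 - s)^-1.
Proof.
move=> s0 s1; rewrite -[leRHS]mul1r ler_pdivlMr ?subr_gt0//.
by rewrite mulrC -[1 - s]opprB mulNr -subrX1 opprB gerBl exprn_ge0.
Qed.

(** The errors of the complete periods add up to at most the geometric series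
    [C / (1 - s)]; the incomplete last period costs at most a constant because
    [f] is nonnegative, so that its integral there is at most that of the whole
    period. *)
Lemma integral_error_bounded (R : realType) (f : R -> R) (d : nat -> R)
    (L D C s : R) :
  {within [set t : R | 0 <= t], continuous f} ->
  (forall t, 0 <= t -> 0 <= f t) ->
  0 <= d 0%N -> (forall k, d k <= d k.+1) -> (forall t, exists k, t < d k) ->
  (forall k, d k.+1 - d k <= D) -> 0 <= s -> s < 1 -> 0 <= C ->
  (forall k, `|\int[@lebesgue_measure R]_(t in `[d k, d k.+1]) f t
               - L * (d k.+1 - d k)| <= C * s ^+ k) ->
  exists M, forall T, d 0%N <= T ->
    `|\int[@lebesgue_measure R]_(t in `[0, T]) f t - L * T| <= M.
Proof.
move=> cf f0 d0 dS dT dD s0 s1 C0 dC.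
have dge k : 0 <= d k by elim: k => // k /le_trans; apply.
pose G T := \int[@lebesgue_measure R]_(t in `[0, T]) f t - L * T.
have Gd k : `|G (d k)| <= `|G (d 0%N)| + C * \sum_(j < k) s ^+ j.
  elim: k => [|k IHk]; first by rewrite big_ord0 mulr0 addr0.
  rewrite big_ord_recr/= mulrDr addrA.
  have -> : G (d k.+1) = G (d k) +
      (\int[@lebesgue_measure R]_(t in `[d k, d k.+1]) f t
       - L * (d k.+1 - d k)).
    by rewrite /G (@Rintegral_chasles _ f 0 (d k) (d k.+1))//; ring.
  by apply: le_trans (ler_normD _ _) _; apply: lerD.
exists (`|G (d 0%N)| + C / (1 - s) + (C + 2 * `|L| * D)) => T dT0.
have [k Tk] := dT T.
have {k Tk} [k [dk Tdk]] : exists k, d k <= T /\ T < d k.+1.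
  elim: k Tk => [|k IHk] Tk; first by rewrite ltNge dT0 in Tk.
  by have [/IHk//|] := ltP T (d k); exists k.
have k0 := dge k.
pose I a b := \int[@lebesgue_measure R]_(t in `[a, b]) f t.
have I0 a b : 0 <= a -> 0 <= I a b.
  move=> a0; apply: Rintegral_ge0 => x /=; rewrite in_itv/= => /andP[ax _].
  by apply: f0; exact: le_trans ax.
have Isplit : I (d k) (d k.+1) = I (d k) T + I T (d k.+1).
  by rewrite /I (@Rintegral_chasles _ f (d k) T)// ltW.
have IT0 : 0 <= I T (d k.+1) by apply: I0; exact: le_trans dk.
have IkT0 := I0 (d k) T k0.
have GT : G T = G (d k) + (I (d k) T - L * (T - d k)).
  by rewrite /G (@Rintegral_chasles _ f 0 (d k) T)// /I; ring.
rewrite -/(G T) GT.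
apply: le_trans (ler_normD _ _) _; apply: lerD.
  apply: le_trans (Gd k) _; rewrite lerD2l ler_wpM2l//.
  exact: geometric_psum_le.
have dDk := dD k; have L0 := normr_ge0 L.
have sk : C * s ^+ k <= C by rewrite ler_piMr// exprn_ile1// ltW.
have /ler_normlP[_ Ik] := le_trans (dC k) sk; rewrite -/(I _ _) in Ik.
have LD : L * (d k.+1 - d k) <= `|L| * D.
  apply: le_trans (ler_norm _) _; rewrite normrM ler_wpM2l// ger0_norm//; lra.
have : `|L * (T - d k)| <= `|L| * D.
  by rewrite normrM ler_wpM2l// ger0_norm//; lra.
move=> /ler_normlP[L1 L2].
by apply/ler_normlP; split; lra.
Qed.

Lemma Rintegral_sum_segment (R : realType) (I : Type) (r : seq I)
    (f : I -> R -> R) (T : R) :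
  (forall i, {within [set t : R | 0 <= t], continuous (f i)}) ->
  \int[@lebesgue_measure R]_(t in `[0, T]) (\sum_(i <- r) f i t) =
  \sum_(i <- r) \int[@lebesgue_measure R]_(t in `[0, T]) f i t.
Proof.
move=> cf.
suff [_] : (@lebesgue_measure R).-integrable `[0, T]
    (EFin \o (fun t => \sum_(i <- r) f i t)) /\
  \int[@lebesgue_measure R]_(t in `[0, T]) (\sum_(i <- r) f i t) =
  \sum_(i <- r) \int[@lebesgue_measure R]_(t in `[0, T]) f i t by [].
have int_f i := integrable_segment T (lexx 0) (cf i).
elim: r => [|i r [int_r IHr]].
  split.
    apply: eq_integrable (integrable0 _ _) => //= t _; rewrite big_nil//.
  rewrite big_nil; under eq_Rintegral do rewrite big_nil.
  by rewrite Rintegral_cst// mul0r.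
split.
  apply: eq_integrable (integrableD _ (int_f i) int_r) => //= t _.
  by rewrite big_cons EFinD.
rewrite big_cons -IHr -RintegralD//.
by apply: eq_Rintegral => t _; rewrite big_cons.
Qed.

(** * The uncertainties seen along the visits of the agent *)

Section Agent.
Context (R : realType) (V : finType) (E : rel V) (rho : V -> V -> R).
Context (A B R0 : V -> R).
Context (rho_ge0 : forall i j : V, E i j -> 0 <= rho i j).
Context (A_gt0 : forall i : V, 0 < A i).
Context (B_gt0 : forall i : V, 0 < B i).
Context (n : nat) (Xi : n.+1.-tuple V).
Context (Xi_uniq : uniq Xi).
Context (Xi_cycle : path.cycle E Xi).
Context (arrive depart : nat -> R) (unc : V -> R -> R).
Context (sched : cyclic_schedule rho Xi arrive depart).
Context (dyn : uncertainty_dynamics A B R0 Xi arrive depart unc).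
Context (leave : leaves_iff_zero Xi arrive depart unc).

Let dwell v := depart v - arrive v.

Lemma leg_time_ge0 (i : 'I_n.+1) : 0 <= leg_time rho Xi i.
Proof.
apply: rho_ge0; have x0 := thead Xi.
rewrite !(tnth_nth x0) /=; case: i => -[|k] /= kn.
  have : E (last x0 Xi) (head x0 Xi).
    by case: {kn} Xi Xi_cycle => -[//|x p] /= _; rewrite rcons_path => /andP[].
  by rewrite -nth0 -nth_last size_tuple modn_small.
rewrite modnDr modn_small; last exact: ltnW.
case: Xi Xi_cycle => -[//|x p] /= /eqP[sp] /(pathP x0) /(_ k).
rewrite size_rcons sp ltnS nth_rcons sp -rcons_cons nth_rcons/= sp.
by rewrite (ltnW kn : (k < n.+1)%N) (kn : (k < n)%N) => /(_ (ltnW kn)).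
Qed.

Lemma dwell_ge0 v : 0 <= dwell v.
Proof. by rewrite subr_ge0; apply: schedule_dwell sched v. Qed.

Lemma depart_le_arriveS v : depart v <= arrive v.+1.
Proof. by rewrite (schedule_travel sched) lerDl leg_time_ge0. Qed.

Lemma arrive_le v w : (v <= w)%N -> arrive v <= arrive w.
Proof.
move=> /subnKC <-; elim: (w - v)%N => [|k IHk]; first by rewrite addn0.
rewrite addnS (le_trans IHk)// (le_trans _ (depart_le_arriveS _))//.
exact: schedule_dwell sched _.
Qed.

Lemma depart_le_arrive v w : (v < w)%N -> depart v <= arrive w.
Proof. by move=> /arrive_le; exact: le_trans (depart_le_arriveS v). Qed.

Lemma depart_le v w : (v <= w)%N -> depart v <= depart w.
Proof.
rewrite leq_eqVlt => /predU1P[->//|/depart_le_arrive vw].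
by apply: le_trans vw _; apply: schedule_dwell sched w.
Qed.

Lemma arrive_ge0 v : 0 <= arrive v.
Proof. by rewrite -(schedule_start sched) arrive_le. Qed.

Lemma depart_ge0 v : 0 <= depart v.
Proof. by apply: le_trans (arrive_ge0 v) _; apply: schedule_dwell sched v. Qed.

Lemma visited_addm v : visited Xi (v + n.+1) = visited Xi v.
Proof. by congr tnth; apply: val_inj; rewrite /= modnDr. Qed.

(** The targets of a cycle are distinct, so that none is visited again before a
    complete tour. *)
Lemma visited_lt_period v j :
  (j < n)%N -> visited Xi (v.+1 + j) != visited Xi v.
Proof.
move=> jn; apply/eqP => /(tuple_uniqP _ Xi_uniq)/(congr1 val)/eqP /=.
rewrite addSnnS -[X in _ == X %[mod _]]addn0 eqn_modDl mod0n modn_small//.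
Qed.

(** While the agent travels no target is attended; the rate is [A i] even where
    the uncertainty is zero, as [A i > 0]. *)
Lemma unc_affine_travel w i :
  affine_on (unc i) (A i) (depart w) (arrive w.+1).
Proof.
apply: affine_on_derive (depart_ge0 w) (unc_continuous dyn (i := i)) _.
move=> t /andP[wt tw]; have t0 := le_lt_trans (depart_ge0 w) wt.
have out v : ~ (arrive v <= t < depart v).
  move=> /andP[vt tv]; have [vw|wv] := leqP v w.
    by have := depart_le vw; lra.
  by have := arrive_le wv; lra.
have nsw : ~ switching_time arrive depart t.
  move=> [v [tv|tv]].
    have [vw|wv] := leqP v w; last by have := arrive_le wv; lra.
    by have := arrive_le vw; have := schedule_dwell sched w; lra.
  have [vw|wv] := leqP v w; first by have := depart_le vw; lra.
  by have := arrive_le wv; have := schedule_dwell sched v; lra.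
have := unc_ode dyn i t0 nsw.
rewrite /agents_at asboolF => [|[v [_ /out]]//].
by rewrite /uncertainty_rate mulr0 leNgt A_gt0 andbF subr0.
Qed.

Lemma agents_at_dwell w i t : arrive w < t < depart w ->
  agents_at Xi arrive depart i t = (visited Xi w == i).
Proof.
move=> /andP[wt tw]; rewrite /agents_at; congr (nat_of_bool _).
apply/asboolP/eqP => [[v [<- /andP[vt tv]]]|<-]; last first.
  by exists w; split=> //; rewrite tw ltW.
have [vw|wv|->//] := ltngtP v w; exfalso.
  by have := depart_le_arrive vw; lra.
by have := depart_le_arrive wv; lra.
Qed.

Lemma dwell_not_switching w t : arrive w < t < depart w ->
  ~ switching_time arrive depart t.
Proof.
move=> /andP[wt tw] [v tv]; have [vw|wv] := ltnP v w.
  by have := depart_le_arrive vw; have := schedule_dwell sched v; lra.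
move: wv; rewrite leq_eqVlt => /predU1P[wv|wv]; first by subst v; lra.
by have := depart_le_arrive wv; have := schedule_dwell sched v; lra.
Qed.

Lemma unc_affine_elsewhere w i : visited Xi w != i ->
  affine_on (unc i) (A i) (arrive w) (depart w).
Proof.
move=> wi.
apply: affine_on_derive (arrive_ge0 w) (unc_continuous dyn (i := i)) _.
move=> t wtw; have /andP[wt tw] := wtw.
have := unc_ode dyn i (le_lt_trans (arrive_ge0 w) wt) (dwell_not_switching wtw).
rewrite (agents_at_dwell i wtw) (negbTE wi).
by rewrite /uncertainty_rate mulr0 leNgt A_gt0 andbF subr0.
Qed.

(** Before the departure the uncertainty of the visited target is not zero, so
    that the clipping of the dynamics at zero does not come into effect. *)
Lemma unc_affine_dwell w :
  let i := visited Xi w in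
  affine_on (unc i) (A i - B i) (arrive w) (depart w).
Proof.
move=> i.
apply: affine_on_derive (arrive_ge0 w) (unc_continuous dyn (i := i)) _.
move=> t wtw; have /andP[wt tw] := wtw.
have := unc_ode dyn i (le_lt_trans (arrive_ge0 w) wt) (dwell_not_switching wtw).
rewrite (agents_at_dwell i wtw) eqxx /uncertainty_rate /= mulr1.
have [unct|//] := eqVneq (unc i t) 0.
have wtw' : arrive w <= t <= depart w by rewrite !ltW.
by exfalso; have := proj2 (leave wtw') unct; lra.
Qed.

(** The interval contains the switching times of the visits to the other
    targets, where no derivative is available: the slope is carried across each
    of them by continuity. *)
Lemma unc_affine_between v :
  let i := visited Xi v in
  affine_on (unc i) (A i) (depart v) (arrive (v + n.+1)%N).
Proof.
move=> i.
suff H k : (k <= n)%N ->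
    affine_on (unc i) (A i) (depart v) (arrive (v.+1 + k)%N).
  by rewrite addnS -addSn; exact: H.
elim: k => [_|k IHk kn]; first by rewrite addn0; exact: unc_affine_travel.
have vk : depart v <= arrive (v.+1 + k)%N by apply: depart_le_arrive; lia.
apply: affine_on_trans (IHk (ltnW kn)) _ => //.
rewrite addnS; apply: affine_on_trans (schedule_dwell sched _) _ _.
  by apply: unc_affine_elsewhere; exact: visited_lt_period.
exact: unc_affine_travel.
Qed.

Lemma unc_depart v : unc (visited Xi v) (depart v) = 0.
Proof.
have vv : arrive v <= depart v <= depart v.
  by rewrite lexx andbT; apply: schedule_dwell sched v.
by apply/(leave vv).
Qed.

Lemma unc_arrive v : let i := visited Xi v in
  unc i (arrive v) = (B i - A i) * dwell v.
Proof.
move=> i; have := @unc_affine_dwell v (depart v).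
rewrite unc_depart lexx andbT (schedule_dwell sched v) => /(_ isT).
by rewrite -/i /dwell; lra.
Qed.

(** The growth [A] over the time away balances the decrease [B - A] over the
    dwell time that follows. *)
Lemma return_time v : let i := visited Xi v in
  A i * (depart (v + n.+1)%N - depart v) = B i * dwell (v + n.+1)%N.
Proof.
move=> i; have := @unc_affine_between v (arrive (v + n.+1)%N).
have := unc_arrive (v + n.+1)%N; rewrite visited_addm /= -/i unc_depart => ->.
rewrite lexx depart_le_arrive; last by lia.
by move=> /(_ isT); rewrite /dwell; lra.
Qed.

(** Area of a triangle, of height [(B i - A i) * dwell (v + n.+1)]. *)
Lemma Rintegral_unc_cycle v : let i := visited Xi v in
  \int[@lebesgue_measure R]_(t in `[depart v, depart (v + n.+1)%N]) unc i t =
  (B i - A i) / 2 * dwell (v + n.+1)%N * (depart (v + n.+1)%N - depart v).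
Proof.
move=> i; have ci := unc_continuous dyn (i := i).
have vm : depart v <= arrive (v + n.+1)%N by apply: depart_le_arrive; lia.
have mm := schedule_dwell sched (v + n.+1)%N.
rewrite (@Rintegral_chasles _ _ _ (arrive (v + n.+1)%N))//; last first.
  exact: depart_ge0.
rewrite (Rintegral_affine (depart_ge0 _) ci vm (@unc_affine_between v)).
have := @unc_affine_dwell (v + n.+1)%N; rewrite visited_addm /= -/i => aff.
rewrite (Rintegral_affine (arrive_ge0 _) ci mm aff).
have := unc_arrive (v + n.+1)%N; rewrite visited_addm /= -/i => ->.
have := unc_depart (v + n.+1)%N; rewrite visited_addm /= -/i => ->.
by rewrite /i unc_depart; field.
Qed.

Lemma departD v k : depart (v + k)%N - depart v =
  \sum_(j < k) (leg_time rho Xi (inZp (v.+1 + j)) + dwell (v.+1 + j)%N).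
Proof.
elim: k => [|k IHk]; first by rewrite addn0 subrr big_ord0.
rewrite big_ord_recr -IHk /= /dwell addnS (schedule_travel sched).
by rewrite -addSn; ring.
Qed.

Let beta_sum := \sum_(i < n.+1) beta A B Xi i.
Context (beta_sum_lt1 : beta_sum < 1).

Let tau_at v : R := tau_eq rho A B Xi (inZp v) 0.

Let beta_at v : R := beta A B Xi (inZp v).

(** The return time of the target, on one side in terms of its own next dwell
    time, on the other side as the duration of a tour. *)
Lemma dwell_recurrence v : dwell (v + n.+1)%N =
  beta_at v * (tour_time rho Xi + \sum_(j < n.+1) dwell (v.+1 + j)%N).
Proof.
have := return_time v; rewrite departD big_split/= sum_period -/(tour_time _ _).
rewrite /beta_at /beta -/(visited Xi v) => H.
have /lt0r_neq0 B0 := B_gt0 (visited Xi v).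
by rewrite mulrAC H mulrC mulKf.
Qed.

(** The values [tau_eq] solve [dwell_recurrence], so that the tour time cancels
    in the recurrence for the deviation from them. *)
Lemma dwell_deviation : exists2 K, 0 <= K &
  forall k v, (k * n.+1 <= v)%N ->
    `|dwell v - tau_at v| <= K * beta_sum ^+ k * beta_at v.
Proof.
have b_gt0 v : 0 < beta_at v by rewrite divr_gt0.
have bper v : beta_at (v + n.+1)%N = beta_at v.
  by congr (beta _ _ _ _); apply: val_inj; rewrite /= modnDr.
have bs v : \sum_(j < n.+1) beta_at (v + j)%N = beta_sum by exact: sum_period.
apply: (lag_recurrence_contracts b_gt0 bper bs beta_sum_lt1) => v.
have tauE w : tau_at w = beta_at w / (1 - beta_sum) * tour_time rho Xi.
  by rewrite /tau_at mxE.
have tau_sum : \sum_(j < n.+1) tau_at (v.+1 + j)%N =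
    beta_sum / (1 - beta_sum) * tour_time rho Xi.
  by under eq_bigr do rewrite tauE; rewrite -!mulr_suml bs.
rewrite big_split/= sumrN tau_sum dwell_recurrence tauE bper; field.
by rewrite subr_eq0 eq_sym lt_eqF.
Qed.

(** The integral of the uncertainty over a return period, compared with the
    claimed mean times the duration, is off by a multiple of [dwell - tau_eq],
    which decreases geometrically. *)
Lemma target_mean (i : 'I_n.+1) :
  T^-1 * \int[@lebesgue_measure R]_(t in `[0, T]) unc (tnth Xi i) t
    @[T --> +oo] -->
  (B (tnth Xi i) - A (tnth Xi i)) / 2 * tau_eq rho A B Xi i 0.
Proof.
set L := (X in _ --> X).
pose x := tnth Xi i.
have xv k : visited Xi (i + k * n.+1)%N = x.
  congr tnth; apply: val_inj.
  by rewrite /= addnC modnMDl modn_small.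
have ik k : inZp (i + k * n.+1) = i :> 'I_n.+1.
  by apply: val_inj; rewrite /= addnC modnMDl modn_small.
pose d k := depart (i + k * n.+1)%N.
pose c := B x / A x.
have c0 : 0 <= c by rewrite divr_ge0// ltW.
have dS k : d k.+1 = depart (i + k * n.+1 + n.+1)%N.
  by rewrite /d mulSn addnCA addnC.
(* c is the ratio of the return time to the dwell time. *)
have dSd k : d k.+1 - d k = c * dwell (i + k * n.+1 + n.+1)%N.
  have := return_time (i + k * n.+1)%N; rewrite /= xv -dS -/(d k) => H.
  by rewrite /c mulrAC -H mulrAC mulfV ?mul1r ?gt_eqF.
have [K K0 dev] := dwell_deviation.
have tauE k : tau_at (i + k * n.+1 + n.+1)%N = tau_eq rho A B Xi i 0.
  rewrite /tau_at; congr (tau_eq _ _ _ _ _ _); rewrite -[RHS](ik k.+1).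
  by congr inZp; lia.
have bE k : beta_at (i + k * n.+1 + n.+1)%N = beta A B Xi i.
  rewrite /beta_at; congr (beta _ _ _ _); rewrite -[RHS](ik k.+1).
  by congr inZp; lia.
have s0 : 0 <= beta_sum by apply: sumr_ge0 => j _; rewrite divr_ge0// ltW.
have bi0 : 0 <= beta A B Xi i by rewrite divr_ge0// ltW.
pose ti : R := tau_eq rho A B Xi i 0; rewrite -/ti in L tauE *.
have devi k : `|dwell (i + k * n.+1 + n.+1)%N - ti| <=
    K * beta A B Xi i * beta_sum ^+ k.
  rewrite -(tauE k) -(bE k) mulrAC; apply: dev; lia.
pose X := ti + K * beta A B Xi i.
have dwellX k : dwell (i + k * n.+1 + n.+1)%N <= X.
  rewrite -lerBlDl; apply: le_trans (ler_norm _) _.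
  apply: le_trans (devi k) _; rewrite ler_piMr//; first exact: mulr_ge0.
  by apply: exprn_ile1 => //; exact: ltW.
have X0 : 0 <= X := le_trans (dwell_ge0 _) (dwellX 0%N).
have [|k|t|k||||k|M dM] := @integral_error_bounded _ (unc x) d L (c * X)
    (`|B x - A x| / 2 * X * c * (K * beta A B Xi i)) beta_sum
    (unc_continuous dyn (i := x)) (unc_ge0 dyn x).
- exact: depart_ge0.
- by rewrite dS; apply: depart_le; lia.
- have [v tv] := schedule_forever sched t; exists v.
  apply: lt_le_trans tv _; apply: le_trans (schedule_dwell sched v) _.
  by apply: depart_le; nia.
- by rewrite dSd ler_wpM2l.
- done.
- exact: beta_sum_lt1.
- apply: mulr_ge0 (mulr_ge0 K0 bi0); apply: mulr_ge0 c0.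
  by apply: mulr_ge0 X0; rewrite divr_ge0.
- rewrite dSd dS.
  have := Rintegral_unc_cycle (i + k * n.+1)%N; rewrite /= xv => ->.
  rewrite -dS -/(d k) dSd.
  set y := dwell _.
  have -> : (B x - A x) / 2 * y * (c * y) - L * (c * y) =
    (B x - A x) / 2 * y * c * (y - ti) by rewrite /L; ring.
  have y0 : 0 <= y := dwell_ge0 _.
  rewrite 4!normrM (ger0_norm y0) (ger0_norm c0) (@ger0_norm _ 2^-1)//.
  rewrite -[leRHS]mulrA; apply: ler_pM => //; last exact: devi.
    by apply: mulr_ge0 c0; apply: mulr_ge0 y0; rewrite divr_ge0.
  apply: ler_wpM2r => //; apply: ler_wpM2l; last exact: dwellX.
  by rewrite divr_ge0.
exact: mean_cvg_of_bounded_error dM.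
Qed.

End Agent.

(** * The mean cycle uncertainty *)

Theorem theorem1 (R : realType)
  (V : finType) (E : rel V) (rho : V -> V -> R)
  (A B R0 : V -> R)
  (hrho : forall i j : V, E i j -> 0 <= rho i j)
  (hA : forall i : V, 0 < A i)
  (hB : forall i : V, 0 < B i)
  (hR0 : forall i : V, 0 <= R0 i)
  (n : nat) (Xi : n.+1.-tuple V)
  (hXi_uniq : uniq Xi) (hXi_cycle : path.cycle E Xi)
  (arrive depart : nat -> R) (unc : V -> R -> R)
  (hschedule : cyclic_schedule rho Xi arrive depart)
  (hdynamics : uncertainty_dynamics A B R0 Xi arrive depart unc)
  (hleave : leaves_iff_zero Xi arrive depart unc)
  (hschur : schur_stable (invmx (Delta1 A B Xi) *m Delta2 R n))
  (hsum : \sum_(i < n.+1) A (tnth Xi i) / B (tnth Xi i) < 1) :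
  mean_cycle_uncertainty Xi unc T @[T --> +oo] -->
    2^-1 * ((cycle_vector B Xi - cycle_vector A Xi)^T
            *m tau_eq rho A B Xi) 0 0.
Proof.
have -> : 2^-1 * ((cycle_vector B Xi - cycle_vector A Xi)^T
                  *m tau_eq rho A B Xi) 0 0 =
  \sum_(i < n.+1) (B (tnth Xi i) - A (tnth Xi i)) / 2 * tau_eq rho A B Xi i 0.
  rewrite mxE mulr_sumr; apply: eq_bigr => i _.
  by rewrite !mxE; ring.
have meanE T : mean_cycle_uncertainty Xi unc T = \sum_(i < n.+1)
    T^-1 * \int[@lebesgue_measure R]_(t in `[0, T]) unc (tnth Xi i) t.
  rewrite /mean_cycle_uncertainty Rintegral_sum_segment.
    by rewrite big_tuple mulr_sumr.
  by move=> i; exact: (unc_continuous hdynamics (i := i)).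
under eq_cvg do rewrite meanE.
apply: cvg_big => [|i _]; first exact: add_continuous.
exact: (target_mean hrho hA hB hXi_uniq hXi_cycle hschedule hdynamics hleave).
Qed.
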